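(* Let $A$ be an integral domain with fraction field $\mathcal{K}(A)$, let $f_1,\ldots,f_r\in A$ and $f\in A$. Let $P=(A\cap\sum\mathcal{K}(A)^2)[f_1,\ldots,f_r]\subset A$ be the cone of $A$ generated by $A\cap\sum\mathcal{K}(A)^2$ and $f_1,\ldots,f_r$, and let $\Lambda=\{\alpha\in\operatorname{Spec}_{pc}A\mid f_1(\alpha)\geq 0,\ldots,f_r(\alpha)\geq 0\}$. Then: (1) $f\geq 0$ on $\Lambda$ if and only if $fq=p+f^{2m}$ for some $p,q\in P$ and $m\in\mathbb{N}$. (2) $f>0$ on $\Lambda$ if and only if $fq=1+p$ for some $p,q\in P$. (3) $f=0$ on $\Lambda$ if and only if $f^{2m}+p=0$ for some $p\in P$ and $m\in\mathbb{N}$.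
   Context: All rings are commutative and contain $\mathbb{Q}$. $\sum\mathcal{K}(A)^2$ is the set of sums of squares of elements of $\mathcal{K}(A)$. A cone of a ring $B$ is a subset $P\subset B$ with $P+P\subset P$, $P\cdot P\subset P$ and $b^2\in P$ for all $b\in B$; it is proper if $-1\notin P$. If $P$ is a cone of $B$ and $S\subset B$, then $P[S]$ denotes the smallest cone of $B$ containing $P$ and $S$; for $S=\{f_1,\ldots,f_r\}$ one writes $P[f_1,\ldots,f_r]$. An ordering of $A$ is a proper cone $P$ such that $ab\in P$ implies $a\in P$ or $-b\in P$; $\operatorname{Spec}_rA$ is the set of orderings of $A$. For $\alpha\in\operatorname{Spec}_rA$, write $P_\alpha$ for the corresponding cone and $\operatorname{supp}(\alpha)=P_\alpha\cap -P_\alpha$ (a prime ideal); for $a\in A$, $a(\alpha)\geq 0$ means $a\in P_\alpha$, $a(\alpha)>0$ means $a\in P_\alpha\setminus\operatorname{supp}(\alpha)$, and $a(\alpha)=0$ means $a\in\operatorname{supp}(\alpha)$. An ordering $\alpha$ of $A$ is precentral if $A\cap\sum\mathcal{K}(A)^2\subset P_\alpha$; $\operatorname{Spec}_{pc}A\subset\operatorname{Spec}_rA$ is the set of precentral orderings. *)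

(* Defs.v *)
From mathcomp Require Import all_boot all_algebra.
From mathcomp Require Import boolp classical_sets.

Set Implicit Arguments.
Unset Strict Implicit.
Unset Printing Implicit Defensive.

Import GRing.Theory.

Local Open Scope classical_set_scope.
Local Open Scope ring_scope.

Definition contains_rat (B : comNzRingType) : Prop :=
  exists i : {rmorphism rat -> B}, injective i.

Definition sums_of_squares (B : comNzRingType) : set B :=
  [set x | exists s : seq B, x = \sum_(b <- s) b ^+ 2].

Definition cone (B : comNzRingType) (P : set B) : Prop :=
  [/\ forall a b, P a -> P b -> P (a + b),
      forall a b, P a -> P b -> P (a * b)
    & forall b, P (b ^+ 2)].

Definition proper_cone (B : comNzRingType) (P : set B) : Prop :=
  cone P /\ ~ P (-1).

(* P[S] *)
Definition cone_adjoin (B : comNzRingType) (P S : set B) : set B :=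
  smallest (@cone B) (P `|` S).

Definition ordering (B : comNzRingType) (P : set B) : Prop :=
  proper_cone P /\ forall a b, P (a * b) -> P a \/ P (- b).

(* A point alpha of the real spectrum is its cone P_alpha. *)
Definition Spec_r (B : comNzRingType) : set (set B) := [set P | ordering P].

Definition supp (B : comNzRingType) (alpha : set B) : set B :=
  alpha `&` [set - a | a in alpha].

Definition nonneg_at (B : comNzRingType) (a : B) (alpha : set B) : Prop :=
  alpha a.

Definition pos_at (B : comNzRingType) (a : B) (alpha : set B) : Prop :=
  (alpha `\` supp alpha) a.

Definition zero_at (B : comNzRingType) (a : B) (alpha : set B) : Prop :=
  supp alpha a.

(* The intersection of A with the sums of squares of its fraction field, A
   being embedded in {fraction A} by tofrac. *)
Definition frac_sums_of_squares (A : idomainType) : set A :=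
  (@tofrac A) @^-1` @sums_of_squares {fraction A}.

Definition Spec_pc (A : idomainType) : set (set A) :=
  [set alpha | Spec_r alpha /\ @frac_sums_of_squares A `<=` alpha].

(* Main.v *)
Require Import Defs.
From mathcomp Require Import all_boot all_algebra.
From mathcomp Require Import boolp classical_sets.
From mathcomp Require Import ring.

(** The three equivalences are formal consequences of one separation principle
    in the style of Krull's prime avoidance ([cone_separation]): if a cone [Q0]
    contains a multiplicative set [M] and is disjoint from [-M], then [Q0]
    extends to an ordering still disjoint from [-M].  A cone that is maximal
    with this property is automatically an ordering.

    Since [P] is generated by the elements that the points of [Lambda] are
    required to contain, these points are exactly the orderings above [P].  So
    when no certificate exists it suffices to find an ordering above [P] where
    the sign condition on [f] fails.  Failure of the certificate says, after
    moving [f q] to the other side, that a certain cone is disjoint from a certain [-M]: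
    - for [f >= 0] the cone is [P[-f] = P - fP] and [M] consists of the even
      powers of [f]; an ordering avoiding [-M] cannot contain both [f] and [-f],
      for it would contain [- f ^ 2], hence it omits [f];
    - for [f > 0] the cone is again [P[-f]] and [M = {1}]: any ordering that
      contains [-f] will do;
    - for [f = 0] the cone is [P] itself and [M] consists of the even powers of
      [f]; as before, [f] is outside the support.

    Conversely, a certificate is read at an ordering, using that orderings are
    total and that their supports are prime ([supp_even_power]). *)

Import GRing.Theory.

Local Open Scope classical_set_scope.
Local Open Scope ring_scope.

(** * Cones *)

Section Cones.
Set Implicit Arguments.
Unset Strict Implicit.
Variable B : comNzRingType.
Implicit Types (P Q M : set B) (a b f : B).

Lemma coneD P a b : cone P -> P a -> P b -> P (a + b).
Proof. by case=> PD _ _; apply: PD. Qed.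

Lemma coneM P a b : cone P -> P a -> P b -> P (a * b).
Proof. by case=> _ PM _; apply: PM. Qed.

Lemma cone_sqr P a : cone P -> P (a ^+ 2).
Proof. by case. Qed.

Lemma cone0 P : cone P -> P 0.
Proof. by move=> cP; have := cone_sqr 0 cP; rewrite expr0n. Qed.

Lemma cone1 P : cone P -> P 1.
Proof. by move=> cP; have := cone_sqr 1 cP; rewrite expr1n. Qed.

Lemma cone_even_power P f m : cone P -> P (f ^+ (2 * m)).
Proof. by move=> cP; rewrite mulnC exprM; apply: cone_sqr. Qed.

Lemma suppE P a : supp P a <-> P a /\ P (- a).
Proof.
split=> [[Pa [b Pb bE]]|[Pa PNa]]; first by split; rewrite // -bE opprK.
by split=> //; exists (- a); rewrite ?opprK.
Qed.

Lemma cone_adjoin_cone P Q : cone (cone_adjoin P Q).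
Proof.
split=> [a b Ha Hb R RPQ|a b Ha Hb R RPQ|b R RPQ].
- by apply: coneD (RPQ.1) (Ha R RPQ) (Hb R RPQ).
- by apply: coneM (RPQ.1) (Ha R RPQ) (Hb R RPQ).
- by apply: cone_sqr RPQ.1.
Qed.

(** For a cone [P] this is [P[a]]: the powers of [a] beyond the first are
    absorbed because [a ^ 2] is already in [P]. *)
Definition cone_adjoin1 P a : set B :=
  [set x | exists p q, [/\ P p, P q & x = p + a * q]].

Lemma cone_adjoin1_cone P a : cone P -> cone (cone_adjoin1 P a).
Proof.
move=> cP; split.
- move=> _ _ [p [q [Pp Pq ->]]] [p' [q' [Pp' Pq' ->]]].
  by exists (p + p'), (q + q'); split; [exact: coneD|exact: coneD|ring].
- move=> _ _ [p [q [Pp Pq ->]]] [p' [q' [Pp' Pq' ->]]].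
  exists (p * p' + a ^+ 2 * (q * q')), (p * q' + q * p'); split; last by ring.
  + by apply: coneD => //; apply: coneM => //; [exact: cone_sqr|exact: coneM].
  + by apply: coneD => //; exact: coneM.
- move=> b; exists (b ^+ 2), 0; split; last by rewrite mulr0 addr0.
  + exact: cone_sqr.
  + exact: cone0.
Qed.

Lemma sub_cone_adjoin1 P a : cone P -> P `<=` cone_adjoin1 P a.
Proof.
by move=> cP p Pp; exists p, 0; split; [|exact: cone0|rewrite mulr0 addr0].
Qed.

Lemma mem_cone_adjoin1 P a : cone P -> cone_adjoin1 P a a.
Proof.
by move=> cP; exists 0, 1; split; [exact: cone0|exact: cone1|rewrite mulr1 add0r].
Qed.

(** * Orderings *)

Lemma ordering_total P a : ordering P -> P a \/ P (- a).
Proof. by case=> -[cP _] prP; apply: prP; exact: cone_sqr. Qed.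

Lemma supp_mul P a b : ordering P -> supp P (a * b) -> supp P a \/ supp P b.
Proof.
case=> _ prP /suppE[Pab PNab]; rewrite !suppE.
have := prP a b Pab; have := prP (- a) (- b); have := prP (- a) b.
have := prP a (- b); rewrite mulrN mulNr mulrNN opprK.
by move=> /(_ PNab) ? /(_ PNab) ? /(_ Pab) ? ?; tauto.
Qed.

Lemma supp_even_power P f m : ordering P -> P (- f ^+ (2 * m)) -> supp P f.
Proof.
move=> oP PNf; have [[cP PN1] _] := oP.
have: supp P (f ^+ (2 * m)) by apply/suppE; split=> //; exact: cone_even_power.
elim: (2 * m)%N => [|n IHn]; first by rewrite expr0 => /suppE[_ /PN1].
by rewrite exprS => /(supp_mul oP)[].
Qed.

(** * Separation of a cone from a multiplicative set *)

Definition avoids M P := forall s, M s -> ~ P (- s).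

Lemma maximal_avoiding_cone Q0 M : cone Q0 -> avoids M Q0 ->
  exists Q, [/\ cone Q, Q0 `<=` Q, avoids M Q &
    forall R, cone R -> Q `<=` R -> avoids M R -> R `<=` Q].
Proof.
move=> cQ0 aQ0.
(* The empty set is admitted only to serve as the union of the empty chain. *)
pose good (X : set B) := X = set0 \/ [/\ cone X, Q0 `<=` X & avoids M X].
have [|Q [gQ maxQ]] := @Zorn_bigcup B good.
  move=> F Fgood totF.
  have [[X [FX X0]]|noX] := pselect (exists X, F X /\ X <> set0); last first.
    left; rewrite -subset0 => x [X FX Xx].
    by apply: noX; exists X; split=> // X0; rewrite X0 in Xx.
  have goodE Y y : F Y -> Y y -> [/\ cone Y, Q0 `<=` Y & avoids M Y].
    by move=> FY Yy; case: (Fgood _ FY) => // Y0; rewrite Y0 in Yy.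
  have [cX Q0X aX] : [/\ cone X, Q0 `<=` X & avoids M X] by case: (Fgood _ FX).
  (* Any two members of a union of a chain lie in a common member. *)
  have join a b : (\bigcup_(Y in F) Y) a -> (\bigcup_(Y in F) Y) b ->
      exists Y, [/\ F Y, Y a & Y b].
    move=> [Y FY Ya] [Z FZ Zb].
    by case: (totF _ _ FY FZ) => YZ; [exists Z|exists Y]; split=> //; exact: YZ.
  right; split; first split.
  - move=> a b Ua Ub; have [Y [FY Ya Yb]] := join a b Ua Ub.
    by exists Y => //; have [cY _ _] := goodE _ _ FY Ya; exact: coneD.
  - move=> a b Ua Ub; have [Y [FY Ya Yb]] := join a b Ua Ub.
    by exists Y => //; have [cY _ _] := goodE _ _ FY Ya; exact: coneM.
  - by move=> b; exists X => //; exact: cone_sqr.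
  - by move=> x Q0x; exists X => //; exact: Q0X.
  - by move=> s Ms [Y FY YNs]; have [_ _ /(_ _ Ms)] := goodE _ _ FY YNs; apply.
have maxQ' R : cone R -> Q0 `<=` R -> Q `<=` R -> avoids M R -> R `<=` Q.
  move=> cR Q0R QR aR; apply: contrapT => RQ.
  by apply: (maxQ R); [split|right].
case: gQ => [Q_0|[cQ Q0Q aQ]].
  by have := maxQ' Q0 cQ0 (fun=> id); rewrite Q_0 => /(_ (@sub0set _ _) aQ0 _ (cone0 cQ0)).
by exists Q; split=> // R cR QR; apply: maxQ' => //; exact: subset_trans QR.
Qed.

(** If [a] and [-b] both fail to lie in a maximal [Q], then [Q[a]] and [Q[-b]]
    meet [-M], giving [a y = - (s + x)] and [b w = t + z] with [s], [t] in [M];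
    multiplying the two relations puts [- s t] in [Q] as soon as [a b] is. *)
Lemma cone_separation Q0 M : cone Q0 -> M `<=` Q0 -> M 1 ->
    (forall s t, M s -> M t -> M (s * t)) -> avoids M Q0 ->
  exists Q, [/\ ordering Q, Q0 `<=` Q & avoids M Q].
Proof.
move=> cQ0 MQ0 M1 MM aQ0.
have [Q [cQ Q0Q aQ maxQ]] := maximal_avoiding_cone cQ0 aQ0.
have MQ : M `<=` Q := subset_trans MQ0 Q0Q.
exists Q; split=> //; split; first by split=> //; exact: aQ.
have adjoin a : ~ Q a -> exists s x y, [/\ M s, Q x, Q y & - s = x + a * y].
  move=> Qa; apply: contrapT => none; apply: Qa.
  apply: (maxQ (cone_adjoin1 Q a)); last exact: mem_cone_adjoin1.
  - exact: cone_adjoin1_cone.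
  - exact: sub_cone_adjoin1.
  - by move=> s Ms [x [y [Qx Qy sE]]]; apply: none; exists s, x, y.
move=> a b Qab; apply: contrapT => /not_orP[/adjoin[s [x [y [Ms Qx Qy sE]]]]].
move=> /adjoin[t [z [w [Mt Qz Qw tE]]]].
apply: (aQ _ (MM _ _ Ms Mt)).
have -> : - (s * t) = a * b * (y * w) + (s * z + x * t + x * z).
  have -> : s = - (x + a * y) by rewrite -sE opprK.
  have -> : t = - (z + - b * w) by rewrite -tE opprK.
  by ring.
have [Qs Qt] := (MQ _ Ms, MQ _ Mt).
by repeat (apply: coneD => // || apply: coneM => //).
Qed.

Definition even_powers f : set B := [set f ^+ (2 * m) | m in [set: nat]].

Lemma cone_separation_even_powers Q0 f : cone Q0 -> avoids (even_powers f) Q0 ->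
  exists Q, [/\ ordering Q, Q0 `<=` Q & ~ supp Q f].
Proof.
move=> cQ0 aQ0; have [|||Q [oQ Q0Q aQ]] := cone_separation cQ0 _ _ _ aQ0.
- by move=> _ [m _ <-]; exact: cone_even_power.
- by exists 0%N.
- by move=> _ _ [m _ <-] [n _ <-]; exists (m + n)%N; rewrite // mulnDr exprD.
exists Q; split=> // /suppE[Qf QNf].
have [[cQ _] _] := oQ; apply: (aQ (f ^+ (2 * 1))); first by exists 1%N.
by rewrite expr2 -mulrN; exact: coneM.
Qed.

End Cones.

(** * Sign certificates over the precentral spectrum *)

Theorem theorem1 (A : idomainType) (A_Q : contains_rat A)
    (r : nat) (fs : 'I_r -> A) (f : A) :
  let P : set A := cone_adjoin (@frac_sums_of_squares A) (range fs) in
  let Lambda : set (set A) :=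
    [set alpha | Spec_pc alpha /\ forall i : 'I_r, nonneg_at (fs i) alpha] in
  [/\ (forall alpha, Lambda alpha -> nonneg_at f alpha) <->
        (exists (p q : A) (m : nat),
           [/\ P p, P q & f * q = p + f ^+ (2 * m)%N]),
      (forall alpha, Lambda alpha -> pos_at f alpha) <->
        (exists p q : A, [/\ P p, P q & f * q = 1 + p])
    & (forall alpha, Lambda alpha -> zero_at f alpha) <->
        (exists (p : A) (m : nat), P p /\ f ^+ (2 * m)%N + p = 0)].
Proof.
move=> P Lambda.
have cP : cone P by exact: cone_adjoin_cone.
have cPf : cone (cone_adjoin1 P (- f)) by exact: cone_adjoin1_cone.
have LambdaE alpha : Lambda alpha <-> ordering alpha /\ P `<=` alpha.
  split=> [[[oa pca] fsa]|[oa Pa]].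
    split=> // x; apply; split; first by case: oa => -[].
    by move=> y [/pca//|[i _ <-]]; exact: fsa.
  split=> [|i]; first split=> // x Sx.
    by apply: Pa => R [_]; apply; left.
  by apply: Pa => R [_]; apply; right; exists i.
split; split.
- move=> f_ge0; apply: contrapT => none.
  have [|Q [oQ PfQ Qf]] := @cone_separation_even_powers A _ f cPf.
    move=> _ [m _ <-] [p [q [Pp Pq E]]]; apply: none; exists p, q, m; split=> //.
    by apply/eqP; rewrite -subr_eq0 -(opprK (f ^+ _)) E; apply/eqP; ring.
  apply: Qf; apply/suppE; split.
    apply: f_ge0; apply/LambdaE; split=> //.
    exact: subset_trans (sub_cone_adjoin1 _ cP) PfQ.
  by apply: PfQ; exact: mem_cone_adjoin1.
- move=> [p [q [m [Pp Pq E]]]] alpha /LambdaE[oa Pa]; have [[ca _] _] := oa.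
  case: (ordering_total f oa) => // aNf.
  suff /suppE[]: supp alpha f by [].
  apply: (@supp_even_power _ _ _ m oa).
  have -> : - f ^+ (2 * m) = (- f) * q + p by rewrite mulNr E; ring.
  by apply: coneD => //; [apply: coneM => //|]; exact: Pa.
- move=> f_gt0; apply: contrapT => none.
  have [||||Q [oQ PfQ _]] := @cone_separation A (cone_adjoin1 P (- f)) [set 1] cPf.
  + by move=> _ ->; exact: cone1.
  + by [].
  + by move=> _ _ -> ->; rewrite mulr1.
  + move=> _ -> [p [q [Pp Pq E]]]; apply: none; exists p, q; split=> //.
    by apply/eqP; rewrite -subr_eq0 -(opprK 1) E; apply/eqP; ring.
  have [|Qf] := f_gt0 Q.
    apply/LambdaE; split=> //.
    exact: subset_trans (sub_cone_adjoin1 _ cP) PfQ.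
  apply; apply/suppE; split=> //.
  by apply: PfQ; exact: mem_cone_adjoin1.
- move=> [p [q [Pp Pq E]]] alpha /LambdaE[oa Pa]; have [[ca aN1] _] := oa.
  have aNf : ~ alpha (- f).
    move=> aNf; apply: aN1.
    have -> : -1 = (- f) * q + p by rewrite mulNr E; ring.
    by apply: coneD => //; [apply: coneM => //|]; exact: Pa.
  by split; [case: (ordering_total f oa)|move=> /suppE[_]].
- move=> f_eq0; apply: contrapT => none.
  have [|Q [oQ PQ]] := @cone_separation_even_powers A _ f cP.
    move=> _ [m _ <-] PN; apply: none; exists (- f ^+ (2 * m)), m.
    by split=> //; rewrite subrr.
  by apply; apply: f_eq0; apply/LambdaE.
- move=> [p [m [Pp E]]] alpha /LambdaE[oa Pa].
  apply: (@supp_even_power _ _ _ m oa).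
  by have -> : - f ^+ (2 * m) = p; [apply/eqP; rewrite eq_sym -addr_eq0 addrC E|exact: Pa].
Qed.
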